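(* For sufficiently large absolute constants $A,K>0$, integers $2\le r\le k$, all sufficiently large $n$, and every $\Delta\ge 1$, the following holds. Let $H$ be an $n$-vertex hypergraph of maximum degree at most $\Delta$ whose edge sizes belong to $\{r,r+1,\ldots,k\}$. Set $$Q=\left\lceil A\,\Delta^{1/(r-1)}\right\rceil,\qquad \ell=\min\left\{Q,\left\lceil K\sqrt{\log n}\right\rceil\right\}.$$ If every vertex $v$ independently receives a uniformly random $\ell$-subset $L(v)\subseteq[Q]$, then $H$ is $L$-colorable with high probability.
   Context: A hypergraph $H=(V,E)$ consists of a finite vertex set $V$ and a set $E$ of subsets of $V$ (edges). A proper coloring assigns a color to each vertex so that no edge is monochromatic. The degree of a vertex is the number of edges containing it. $[Q]=\{1,\dots,Q\}$. Given lists $L(v)$ of colors for $v\in V$, $H$ is $L$-colorable if it has a proper coloring $\chi$ with $\chi(v)\in L(v)$ for every $v\in V$. ''Absolute constants'' means that $A$ and $K$ do not depend on $r,k,n,\Delta$ or $H$. ''With high probability'' means with probability at least $1-n^{-c}$ for some constant $c>0$, over the random lists. Logarithms are natural. *)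

(* Defs.v *)
From HB Require Import structures.
From mathcomp Require Import all_boot all_order all_algebra.
From mathcomp Require Import reals exp.

Set Implicit Arguments.
Unset Strict Implicit.
Unset Printing Implicit Defensive.

Import Order.TTheory GRing.Theory Num.Theory.

Local Open Scope ring_scope.

(* A hypergraph on a finite vertex type V is given by its set of edges
   E : {set {set V}}. *)

Definition degree (V : finType) (E : {set {set V}}) (v : V) : nat :=
  #|[set e in E | v \in e]|.

Definition max_degree (V : finType) (E : {set {set V}}) : nat :=
  (\max_(v : V) degree E v)%N.

(* Edges with at most one vertex are monochromatic under every coloring. *)
Definition monochromatic (V C : finType) (chi : {ffun V -> C}) (e : {set V}) :=
  [forall x in e, forall y in e, chi x == chi y].

Definition proper_coloring (V C : finType) (E : {set {set V}})
    (chi : {ffun V -> C}) : bool :=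
  [forall e in E, ~~ monochromatic chi e].

Definition list_colorable (V C : finType) (E : {set {set V}})
    (L : {ffun V -> {set C}}) : bool :=
  [exists chi : {ffun V -> C},
     proper_coloring E chi && [forall v, chi v \in L v]].

(* Probability mass function of a uniformly random l-subset of C
   (a probability distribution as soon as l <= #|C|). *)
Definition unif_subset (R : realType) (C : finType) (l : nat) (S : {set C}) : R :=
  if #|S| == l then ('C(#|C|, l)%:R)^-1 else 0.

(* Probability of the event P when the lists L v, for v : V, are independent
   uniformly random l-subsets of C: the joint law is the product law. *)
Definition random_lists_pr (R : realType) (V C : finType) (l : nat)
    (P : pred {ffun V -> {set C}}) : R :=
  \sum_(L : {ffun V -> {set C}} | P L) \prod_(v : V) unif_subset R l (L v).

(* The integer ceilings below are of nonnegative reals whenever A, K >= 0 and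
   n >= 1, so that taking the absolute value only converts them to nat. *)
Definition palette_size (R : realType) (A Delta : R) (r : nat) : nat :=
  `|Num.ceil (A * Delta `^ (r%:R - 1)^-1)|%N.

Definition list_size (R : realType) (K : R) (n Q : nat) : nat :=
  minn Q `|Num.ceil (K * Num.sqrt (ln n%:R))|%N.

(* Main.v *)
Require Import Defs.
From HB Require Import structures.
From mathcomp Require Import all_boot all_order all_algebra.
From mathcomp Require Import reals sequences exp.
From mathcomp Require Import ring lra zify.

Set Implicit Arguments.
Unset Strict Implicit.
Unset Printing Implicit Defensive.

Import Order.TTheory GRing.Theory Num.Theory.

Local Open Scope ring_scope.

(** Three ideas combine, with Q = #|C| the palette, l the list size and
    p = l / Q the chance that a given color is in a given list.

    _Counting in place of the local lemma._  Suppose that, from lists of size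
    at least l / 2, each vertex v and color c of its list satisfy Y_c(v) <=
    1/2, where Y_c(v) sums (4 / l) ^ (|f| - 1) over the edges f through v all
    of whose other vertices have c in their lists.  Then each vertex multiplies
    the number of partial colorings by at least l / 4, since a coloring that
    makes f monochromatic is determined by its restriction to the complement
    of f ([list_coloring_by_counting]).  A vertex may thus discard its heavy
    colors, those with Y_c(v) > 1/2, and the only failure is a vertex for
    which at least half of the list is heavy.

    _Removing high codegrees._  A vertex at which many edges share a second
    vertex w can have Y_c(v) large as soon as c is in L(w), far too likely an
    event.  If a set S of size at least 2 is contained in edges of total weight
    more than that of S itself, with weight y ^ |f| for f and y = 320 / Q, all
    those edges are replaced by S; this only makes the coloring problem harder,
    raises the weight at no vertex and lowers the total.  A hypergraph of least total weight is then
    spread: above every nonempty S the edges weigh at most as much as S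
    ([codegree_reduction]).  The bound on Delta is used only to start: the
    edges at a vertex, without that vertex, weigh at most 1
    ([initial_weight]).

    _Exposing vertices until the cost is exponential in l._  In a spread
    hypergraph a color is heavy at v with probability at most exp(- Omega(l)):
    the vertices known to have c explain only a sum of 1/4 while there are
    fewer than l / 20 of them, so another edge, with a new vertex, has to be
    present, and by spreadness each new vertex costs a constant factor 1/16
    ([witness_weights]).  This bound is a polynomial with nonnegative
    coefficients in the events that c is in L(u), and such events are negatively
    correlated over c inside a uniform l-subset, so that the bounds for distinct
    colors multiply ([joint_witness_bound]).  Half of a list is therefore heavy
    with probability at most exp(- Omega(l ^ 2)) ([many_bad_colors_pr]), which
    is below n ^ (-2) as l >= 20 sqrt (ln n) ([failure_le]).  In the other case
    l = Q, no color is ever heavy ([heavy_never]). *)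

(** * Sums and products *)

Lemma ler_sum_subpred (R : numDomainType) (I : finType) (P Q : pred I)
    (F : I -> R) :
  (forall i, P i -> Q i) -> (forall i, 0 <= F i) ->
  \sum_(i | P i) F i <= \sum_(i | Q i) F i.
Proof.
move=> PQ F_ge0; rewrite big_mkcond [leRHS]big_mkcond; apply: ler_sum => i _.
by case: ifPn => [/PQ-> //|_]; case: ifP.
Qed.

Lemma prodr_ge1 (R : realDomainType) (I : finType) (P : pred I) (F : I -> R) :
  (forall i, P i -> 1 <= F i) -> 1 <= \prod_(i | P i) F i.
Proof.
by move=> F_ge1; apply: (big_ind (fun z => 1 <= z)) => // x y; exact: mulr_ege1.
Qed.

Lemma leq_card_bigcup (I T : finType) (P : pred I) (A : I -> {set T}) :
  (#|\bigcup_(i | P i) A i| <= \sum_(i | P i) #|A i|)%N.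
Proof.
apply: (big_ind2 (fun (B : {set T}) m => #|B| <= m)%N) => //.
  by rewrite cards0.
move=> B m B' m' hB hB'; apply: leq_trans (leq_card_setU _ _) _.
exact: leq_add.
Qed.

(** Each element of U is either outside T, contributing 1, or in it,
    contributing x. *)
Lemma sum_expr_subset (R : comNzRingType) (V : finType) (x : R)
    (U : {set V}) :
  \sum_(T : {set V} | T \subset U) x ^+ #|T| = (1 + x) ^+ #|U|.
Proof.
transitivity (\prod_i ((if i \in U then x else 0) + 1)); last first.
  rewrite -prodr_const [RHS]big_mkcond; apply: eq_bigr => i _.
  by case: ifP; rewrite ?add0r // addrC.
rewrite bigA_distr big_mkcond; apply: eq_bigr => J _; rewrite -big_mkcond /=.
case: ifPn => [JU|/subsetPn[i iJ iU]].
  by rewrite -prodr_const; apply: eq_bigr => i /(subsetP JU) ->.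
by rewrite (bigD1 i) //= (negPf iU) mul0r.
Qed.

(** * Counting list colorings *)

(** The value None outside S makes a coloring of the subset S a function on the
    whole of V, so that colorings of all subsets are counted in one type. *)
Definition partial_coloring (V C : finType) (F : {set {set V}})
    (L : V -> {set C}) (S : {set V}) (chi : {ffun V -> option C}) : bool :=
  [forall u, if u \in S then [exists c in L u, chi u == Some c]
             else chi u == None] &&
  [forall f in F, (f \subset S) ==>
     ~~ [exists c, [forall u in f, chi u == Some c]]].

Definition nb_partial_colorings (V C : finType) (F : {set {set V}})
    (L : V -> {set C}) (S : {set V}) : nat :=
  #|[set chi | partial_coloring F L S chi]|.

(** The colors on T are all known, so erasing them loses nothing, and what is
    left colors S minus T properly. *)
Lemma nb_partial_colorings_erase (V C : finType) (F : {set {set V}})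
    (L : V -> {set C}) (S T : {set V}) (c : C) :
  (#|[set chi | partial_coloring F L S chi &
        [forall u in T, chi u == Some c]]| <=
   nb_partial_colorings F L (S :\: T))%N.
Proof.
pose erase (chi : {ffun V -> option C}) :=
  [ffun u => if u \in T then None else chi u].
rewrite -(@card_in_imset _ _ erase) => [|chi chi']; last first.
  rewrite !inE => /andP[_ /forall_inP hT] /andP[_ /forall_inP hT'] /ffunP eqe.
  apply/ffunP => u; have := eqe u; rewrite !ffunE.
  by case: ifPn => // uT _; rewrite (eqP (hT _ uT)) (eqP (hT' _ uT)).
apply/subset_leq_card/subsetP => _ /imsetP[chi + ->].
rewrite !inE => /andP[/andP[/forallP hS /forall_inP hF] /forall_inP hT].
apply/andP; split.
  apply/forallP => u; have := hS u; rewrite !inE ffunE.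
  by case: (u \in T) (u \in S) => [] [].
apply/forall_inP => f fF; apply/implyP => fST.
have /implyP/(_ (subset_trans fST (subsetDl _ _))) := hF f fF.
apply: contra => /existsP[d /forall_inP hd]; apply/existsP; exists d.
apply/forall_inP => u uf; have := hd u uf; rewrite ffunE.
by have := subsetP fST u uf; rewrite !inE => /andP[/negPf ->].
Qed.

(** Of the extensions of the colorings of S by a color c at v, only those that
    make some edge f through v monochromatic are lost.  For each f they are as
    many as the colorings of S that are constant equal to c on f minus v, at
    most the number of colorings of S minus f; the chain hypothesis, which is
    what induction provides, compares it with the number for S. *)
Lemma nb_partial_colorings_extend (R : realFieldType) (V C : finType)
    (F : {set {set V}}) (L : V -> {set C}) (b : R) (S : {set V}) (v : V) :
  0 < b -> v \notin S -> (forall f, f \in F -> (2 <= #|f|)%N) ->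
  b <= \sum_(c in L v)
         (1 - \sum_(f in F | (v \in f) && [forall u in f :\ v, c \in L u])
                b ^- #|f|.-1) ->
  (forall T : {set V}, T \subset S ->
     (nb_partial_colorings F L T)%:R * b ^+ #|S :\: T| <=
     (nb_partial_colorings F L S)%:R) ->
  b * (nb_partial_colorings F L S)%:R <=
    (nb_partial_colorings F L (v |: S))%:R.
Proof.
move=> b_gt0 vS Fsize hb chain; set N := nb_partial_colorings F L.
pose ext (c : C) (chi : {ffun V -> option C}) :=
  [ffun u => if u == v then Some c else chi u].
pose good c := [set chi | partial_coloring F L S chi &
                          partial_coloring F L (v |: S) (ext c chi)].
pose bad c (f : {set V}) := [set chi | partial_coloring F L S chi &
                          [forall u in f :\ v, chi u == Some c]].
have good_le : (\sum_(c in L v) #|good c| <= N (v |: S))%N.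
  pose G := [set q : C * {ffun V -> option C} |
              (q.1 \in L v) && (q.2 \in good q.1)].
  have -> : (\sum_(c in L v) #|good c| = #|G|)%N.
    under eq_bigr => c _ do rewrite -sum1_card.
    rewrite pair_big_dep /= -sum1_card.
    by apply: eq_big => // q; rewrite [RHS]inE.
  rewrite -(@card_in_imset _ _ (fun q => ext q.1 q.2)).
    apply/subset_leq_card/subsetP => _ /imsetP[[c chi] + ->].
    by rewrite !inE => /andP[_ /andP[]].
  move=> [c chi] [c' chi']; rewrite !inE /=.
  move=> /and3P[_ /andP[/forallP h _] _].
  move=> /and3P[_ /andP[/forallP h' _] _] /ffunP eqe.
  have := eqe v; rewrite !ffunE eqxx => -[->]; congr (_, _); apply/ffunP => u.
  have := eqe u; rewrite !ffunE; case: eqP => // -> _.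
  by have := h v; have := h' v; rewrite (negPf vS) => /eqP-> /eqP->.
have bad_le c f : f \in F -> v \in f ->
  (#|bad c f|%:R : R) <= b ^- #|f|.-1 * (N S)%:R.
  (* If some coloring is constant on f minus v, this set lies inside S. *)
  move=> fF vf; have [->|[chi]] := set_0Vmem (bad c f).
    by rewrite cards0 mulr_ge0 ?invr_ge0 ?exprn_ge0 ?(ltW b_gt0).
  rewrite inE => /andP[/andP[/forallP hS _] /forall_inP hf].
  have fS : f :\ v \subset S.
    apply/subsetP => u uf; have := hS u; case: ifP => // _.
    by rewrite (eqP (hf u uf)).
  rewrite mulrC ler_pdivlMr ?exprn_gt0 //.
  apply: le_trans (chain (S :\: (f :\ v)) (subsetDl _ _)).
  rewrite (setDDr S S) setDv set0U (setIidPr fS) (cardsD1 v f) vf /=.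
  apply: ler_wpM2r; first by rewrite exprn_ge0 ?(ltW b_gt0).
  by rewrite ler_nat; apply: nb_partial_colorings_erase.
have split_le c : c \in L v ->
  (N S <= #|good c| +
     \sum_(f in F | (v \in f) && [forall u in f :\ v, c \in L u]) #|bad c f|)%N.
  move=> cv.
  apply: leq_trans (leq_add (leqnn _) (leq_card_bigcup _ _)).
  apply: leq_trans (leq_card_setU _ _); apply/subset_leq_card/subsetP => chi.
  rewrite !inE => hchi; rewrite hchi /=.
  have [//|] := boolP (partial_coloring F L (v |: S) (ext c chi)).
  have [/forallP hS /forall_inP hF] := andP hchi.
  rewrite negb_and => /orP[/forallPn[u]|/forall_inPn[f fF]].
    rewrite !inE ffunE; have := hS u; case: (eqVneq u v) => [->|_] //=; first move=> _.
      by case/negP; apply/exists_inP; exists c.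
    by move=> ->.
  rewrite negb_imply negbK => /andP[fvS /existsP[d /forall_inP hd]].
  have vf : v \in f.
    apply: contraT => vf; have fS : f \subset S.
      apply/subsetP => u uf; have := subsetP fvS u uf; rewrite !inE.
      by case/orP => // /eqP uv; rewrite -uv uf in vf.
    have := implyP (hF f fF) fS; apply/contraNT => _; apply/existsP; exists d.
    apply/forall_inP => u uf; have := hd u uf; rewrite ffunE.
    by case: (eqVneq u v) => // uv; rewrite -uv uf in vf.
  have dc : d = c by have := hd v vf; rewrite ffunE eqxx => /eqP[].
  have hc u : u \in f :\ v -> chi u == Some c.
    by rewrite !inE => /andP[/negPf uv uf]; have := hd u uf; rewrite ffunE uv dc.
  apply/bigcupP; exists f; last by rewrite inE hchi; apply/forall_inP.
  rewrite fF vf; apply/forall_inP => u uf; have := hS u.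
  case: ifP => _; rewrite (eqP (hc u uf)) //.
  by case/exists_inP => c' c'L /eqP[->].
have N_ge0 : (0 : R) <= (N S)%:R by rewrite ler0n.
apply: le_trans (ler_wpM2r N_ge0 hb) _.
apply: le_trans (_ : (\sum_(c in L v) #|good c|)%N%:R <= _);
  last by rewrite ler_nat.
rewrite natr_sum mulr_suml; apply: ler_sum => c cv.
rewrite mulrBl mul1r lerBlDr.
have := split_le c cv; rewrite -(ler_nat R) => /le_trans; apply.
rewrite natrD lerD2l natr_sum mulr_suml; apply: ler_sum => f /and3P[fF vf _].
exact: bad_le.
Qed.

(** Rosenfeld's counting argument: if the hypothesis holds, adding a vertex to S
    multiplies the number of colorings of S by at least b, by induction on S, so
    that there is a coloring of the whole vertex set. *)
Lemma list_coloring_by_counting (R : realFieldType) (V C : finType)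
    (F : {set {set V}}) (L : V -> {set C}) (b : R) :
  0 < b -> (forall f, f \in F -> (2 <= #|f|)%N) ->
  (forall v, b <= \sum_(c in L v)
         (1 - \sum_(f in F | (v \in f) && [forall u in f :\ v, c \in L u])
                b ^- #|f|.-1)) ->
  exists2 chi : {ffun V -> C}, forall v, chi v \in L v &
    forall f, f \in F -> ~~ monochromatic chi f.
Proof.
move=> b_gt0 Fsize hb; set N := nb_partial_colorings F L.
have chain (S T : {set V}) : T \subset S ->
    (N T)%:R * b ^+ #|S :\: T| <= (N S)%:R.
  have [n] := ubnP #|S|; elim: n S T => // n IHn S T.
  rewrite ltnS => Sn TS.
  have [/eqP|[v]] := set_0Vmem (S :\: T).
    rewrite setD_eq0 => ST.
    have -> : T = S by apply/eqP; rewrite eqEsubset TS.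
    by rewrite setDv cards0 mulr1.
  rewrite inE => /andP[vT vS].
  have Sv_n : (#|S :\ v| < n)%N by rewrite (cardsD1 v S) vS in Sn.
  have step : b * (N (S :\ v))%:R <= (N S)%:R.
    have := @nb_partial_colorings_extend R V C F L b (S :\ v) v.
    rewrite setD1K // setD11; apply=> // T' T'S; exact: IHn.
  apply: le_trans step.
  have -> : #|S :\: T| = (#|(S :\ v) :\: T|).+1.
    rewrite (cardsD1 v) inE vT vS add1n; congr _.+1; apply: eq_card => u.
    by rewrite !inE; do !case: (_ \in _); do ?case: (_ == _).
  rewrite exprS mulrCA ler_wpM2l ?(ltW b_gt0) // IHn //.
  by rewrite subsetD1 TS.
have N0 : (0 < N set0)%N.
  apply/card_gt0P; exists [ffun=> None]; rewrite inE; apply/andP; split.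
    by apply/forallP => u; rewrite inE ffunE.
  apply/forall_inP => f fF; rewrite subset0; apply/implyP => /eqP f0.
  by have := Fsize f fF; rewrite f0 cards0.
have : (0 < N setT)%N.
  rewrite -(ltr0n R); apply: lt_le_trans (chain setT set0 (sub0set _)).
  by rewrite mulr_gt0 ?ltr0n ?exprn_gt0.
case/card_gt0P => chi; rewrite inE => /andP[/forallP hL /forall_inP hF].
have /fin_all_exists[phi hphi] v : exists c, c \in L v /\ chi v = Some c.
  by have := hL v; rewrite inE => /exists_inP[c cL /eqP cE]; exists c.
exists [ffun v => phi v] => [v|f fF]; first by rewrite ffunE; case: (hphi v).
have /implyP/(_ (subsetT _)) := hF f fF; apply: contra => mono.
have /card_gt0P[w wf] : (0 < #|f|)%N by apply: leq_trans (Fsize f fF).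
apply/existsP; exists (phi w); apply/forall_inP => u uf.
have /forall_inP/(_ w wf)/eqP := forall_inP mono u uf; rewrite !ffunE => <-.
by case: (hphi u) => _ ->.
Qed.

(** * Bounding codegrees *)

(** F is a hypergraph of minimum total weight among those that refine E and have
    no vertex of weight above y.  If the edges of F properly above some S weighed
    more than S, replacing them by S would keep these conditions and lower the
    weight. *)
Lemma codegree_reduction (R : realFieldType) (V : finType)
    (E : {set {set V}}) (y : R) :
  0 < y -> (forall e, e \in E -> (2 <= #|e|)%N) ->
  (forall v, \sum_(e in E | v \in e) y ^+ #|e| <= y) ->
  exists F : {set {set V}},
    [/\ forall e, e \in E -> exists2 f, f \in F & f \subset e,
        forall f, f \in F -> (2 <= #|f|)%N &
        forall S, S != set0 ->
          \sum_(f in F | S \proper f) y ^+ #|f| <= y ^+ #|S|].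
Proof.
move=> y_gt0 Esize Edeg.
have yX_ge0 (f : {set V}) : 0 <= y ^+ #|f| by rewrite exprn_ge0 ?ltW.
pose ok (F : {set {set V}}) :=
  [&& [forall e in E, exists f in F, f \subset e],
      [forall f in F, (2 <= #|f|)%N] &
      [forall v, \sum_(f in F | v \in f) y ^+ #|f| <= y]].
pose weight (F : {set {set V}}) := \sum_(f in F) y ^+ #|f|.
have okE : ok E.
  apply/and3P; split.
  - by apply/forall_inP => e eE; apply/exists_inP; exists e.
  - by apply/forall_inP.
  - by apply/forallP.
case: (arg_minP weight okE) => F /and3P[Fcov Fsize Fdeg] Fmin.
exists F; split.
- by move=> e eE; have /exists_inP := forall_inP Fcov e eE.
- exact: (forall_inP Fsize).
move=> S S_neq0; have [S_gt1|S_le1] := ltnP 1 #|S|; last first.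
  have /cards1P[v ->] : #|S| == 1%N by rewrite eqn_leq S_le1 card_gt0.
  rewrite cards1 expr1; apply: le_trans (forallP Fdeg v).
  apply: ler_sum_subpred => [f /andP[->] + |//].
  by move/proper_sub; rewrite sub1set.
rewrite leNgt; apply/negP => heavy.
pose F' := S |: [set f in F | ~~ (S \proper f)].
have F'_le (P : pred {set V}) : \sum_(f in F' | P f) y ^+ #|f| <=
    (P S)%:R * y ^+ #|S| + \sum_(f in F | P f && ~~ (S \proper f)) y ^+ #|f|.
  have GE : \sum_(f in F | P f && ~~ (S \proper f)) y ^+ #|f| =
      \sum_(f in [set f in F | ~~ (S \proper f)]) (if P f then y ^+ #|f| else 0).
    rewrite -big_mkcondr; apply: eq_bigl => f.
    by rewrite inE -andbA; congr (_ && _); rewrite andbC.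
  rewrite GE big_mkcondr /= /F'.
  have [SG|SG] := boolP (S \in [set f in F | ~~ (S \proper f)]).
    by rewrite (setUidPr _) ?sub1set // lerDr mulr_ge0 ?exprn_ge0 ?(ltW y_gt0).
  by rewrite big_setU1 //= lerD2r; case: (P S); rewrite ?mul1r ?mul0r.
have okF' : ok F'.
  apply/and3P; split.
  - apply/forall_inP => e eE; apply/exists_inP.
    have /exists_inP[f fF fe] := forall_inP Fcov e eE.
    have [Sf|Sf] := boolP (S \proper f).
      by exists S; rewrite ?setU11 // (subset_trans (proper_sub Sf)).
    by exists f; rewrite // !inE fF Sf orbT.
  - apply/forall_inP => f; rewrite !inE => /orP[/eqP-> // | /andP[fF _]].
    exact: (forall_inP Fsize).
  - apply/forallP => v; apply: le_trans (F'_le _) _.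
    apply: le_trans (forallP Fdeg v).
    rewrite [leRHS](bigID (fun f : {set V} => S \proper f)) /=.
    apply: lerD; last by apply: ler_sum_subpred => // f; rewrite andbA.
    have [vS|vS] := boolP (v \in S); last first.
      by rewrite mul0r sumr_ge0 // => f _; rewrite exprn_ge0 ?(ltW y_gt0).
    rewrite mul1r; apply: le_trans (ltW heavy) _.
    apply: ler_sum_subpred => // f /andP[-> Sf].
    by rewrite (subsetP (proper_sub Sf)).
have := Fmin _ okF'; rewrite leNgt => /negP; apply.
rewrite /weight (bigID (fun f : {set V} => S \proper f) (mem F)) /=.
apply: (@le_lt_trans _ _ (y ^+ #|S| +
    \sum_(f in F | ~~ (S \proper f)) y ^+ #|f|)); last by rewrite ltrD2r.
apply: (le_trans _ (le_trans (F'_le predT) _)).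
  by apply: ler_sum_subpred => // f; rewrite andbT.
by rewrite mul1r lerD2l.
Qed.

(** * Witnesses of a heavy color *)

(** When the set U of present vertices grows to U with g, each new vertex brings
    a factor p for its presence and a factor 1 / e for the lost credit.  Grouping
    the sets g by T, their common part with U, the new vertices sum to at most
    theta by spreadness and the choices of T to (1 + x) ^ |U|. *)
Lemma expansion_cost (R : realFieldType) (V : finType) (G : {set {set V}})
    (x p e theta : R) (N : nat) (U : {set V}) :
  0 <= x -> 0 <= p -> 0 < e <= 1 ->
  (forall T : {set V}, \sum_(g in G | T \proper g)
     (x * p / e) ^+ (#|g| - #|T|) <= theta) ->
  \sum_(g in G | ~~ (g \subset U))
     x ^+ #|g| * (p ^+ #|U :|: g| * e ^+ (N - #|U :|: g|)) <=
  p ^+ #|U| * e ^+ (N - #|U|) * ((1 + x) ^+ #|U| * theta).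
Proof.
move=> x_ge0 p_ge0 /andP[e_gt0 e_le1] spread.
pose z := x * p / e.
have z_ge0 : 0 <= z by rewrite mulr_ge0 ?invr_ge0 ?(ltW e_gt0) // mulr_ge0.
apply: (@le_trans _ _ (p ^+ #|U| * e ^+ (N - #|U|) *
    \sum_(g in G | ~~ (g \subset U)) x ^+ #|U :&: g| * z ^+ #|g :\: U|)).
  rewrite mulr_sumr; apply: ler_sum => g _.
  have gE : #|g| = (#|U :&: g| + #|g :\: U|)%N by rewrite -(cardsID U g) setIC.
  have UgE : #|U :|: g| = (#|U| + #|g :\: U|)%N.
    by rewrite -(cardsID U (U :|: g)) setUK setDUl setDv set0U.
  rewrite gE UgE; move: #|U :&: g| #|g :\: U| => i d.
  have e_le : e ^+ (N - (#|U| + d)) <= e ^+ (N - #|U|) / e ^+ d.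
    rewrite ler_pdivlMr ?exprn_gt0 // -exprD.
    apply: ler_wiXn2l => //; [exact: ltW | lia].
  rewrite /z exprMn exprMn exprVn !exprD.
  have -> : p ^+ #|U| * e ^+ (N - #|U|) * (x ^+ i * (x ^+ d * p ^+ d / e ^+ d)) =
    x ^+ i * x ^+ d * (p ^+ #|U| * p ^+ d * (e ^+ (N - #|U|) / e ^+ d)) by ring.
  by do 2![apply: ler_wpM2l; first by rewrite mulr_ge0 ?exprn_ge0].
apply: ler_wpM2l; first by rewrite mulr_ge0 ?exprn_ge0 ?(ltW e_gt0).
rewrite (partition_big (fun g => U :&: g) (fun T => T \subset U)) /=; last first.
  by move=> g _; exact: subsetIl.
rewrite -sum_expr_subset mulr_suml; apply: ler_sum => T TU.
apply: (@le_trans _ _ (x ^+ #|T| * \sum_(g in G | T \proper g) z ^+ (#|g| - #|T|))).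
  rewrite mulr_sumr big_mkcond [leRHS]big_mkcond; apply: ler_sum => g _.
  case: ifPn => [/andP[/andP[gG gU] /eqP TE]|_]; last first.
    by case: ifP => // _; rewrite mulr_ge0 ?exprn_ge0.
  have Tg : T \proper g.
    by rewrite properE -TE subsetIr /= subsetI negb_and gU.
  rewrite gG Tg TE /= (_ : #|g :\: U| = (#|g| - #|T|)%N) ?TE //.
  by rewrite -TE setIC cardsD.
by apply: ler_wpM2l; rewrite ?exprn_ge0.
Qed.

(** Think of W as a random set that contains any given U with probability at
    most p ^ |U|: then the sum over the members of G inside W exceeds 1/2 with
    probability at most e ^ N, by the union bound over the sets U with weights
    a U.  The union bound is stated through a, and without reference to the law
    of W, because it will be multiplied over several colors.

    The weights are built by exposing members of G: as long as the exposed part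
    U of W has fewer than N elements, its subsets account for at most (1 + x) ^ N
    - 1 <= 1/4 of the sum, hence the members of G in W that leave U account for
    at least 1/4, and four times their sum dominates 1. *)
Lemma witness_weights (R : realFieldType) (V : finType) (G : {set {set V}})
    (x p e theta : R) (N : nat) :
  0 <= x -> 0 <= p -> 0 < e <= 1 -> set0 \notin G ->
  (1 + x) ^+ N <= 5 / 4 -> theta <= 1 / 5 ->
  (forall T : {set V}, \sum_(g in G | T \proper g)
     (x * p / e) ^+ (#|g| - #|T|) <= theta) ->
  exists a : {set V} -> R,
    [/\ forall U, 0 <= a U,
        forall U, a U != 0 -> U \subset cover G,
        forall W : {set V}, 1 / 2 < \sum_(g in G | g \subset W) x ^+ #|g| ->
          1 <= \sum_(U : {set V} | U \subset W) a U &
        \sum_U a U * p ^+ #|U| <= e ^+ N].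
Proof.
move=> x_ge0 p_ge0 e01 G0 xN theta_le spread.
have [e_gt0 e_le1] := andP e01.
suff /(_ N set0) : forall n (U : {set V}),
    (N <= #|U| + n)%N -> U \subset cover G ->
  exists a : {set V} -> R,
    [/\ forall U', 0 <= a U',
        forall U', a U' != 0 -> U' \subset cover G,
        forall W : {set V}, U \subset W ->
          1 / 2 < \sum_(g in G | g \subset W) x ^+ #|g| ->
          1 <= \sum_(U' : {set V} | U' \subset W) a U' &
        \sum_U' a U' * p ^+ #|U'| <= p ^+ #|U| * e ^+ (N - #|U|)].
  case=> [||a [a0 aG aW aN]]; [by rewrite cards0 | exact: sub0set |].
  exists a; split=> // [W|]; first exact/aW/sub0set.
  by move: aN; rewrite cards0 expr0 mul1r subn0.
(* n bounds the number of elements still to be exposed. *)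
elim=> [|n IHn] U hU UG.
  exists (fun U' => (U' == U)%:R); split=> [U'|U'|W UW _|]; first by rewrite ler0n.
  - by case: (eqVneq U' U) => [-> //|_]; rewrite eqxx.
  - by rewrite (bigD1 U) //= eqxx lerDl sumr_ge0.
  rewrite (bigD1 U) //= eqxx mul1r big1; last by move=> U' /negPf ->; rewrite mul0r.
  by rewrite addn0 in hU; rewrite addr0 (eqP hU) mulr1.
have [NU|NU] := leqP N (#|U| + n); first exact: IHn.
have Hg (g : {set V}) : exists a : {set V} -> R, g \in G -> ~~ (g \subset U) ->
    [/\ forall U', 0 <= a U',
        forall U', a U' != 0 -> U' \subset cover G,
        forall W : {set V}, U :|: g \subset W ->
          1 / 2 < \sum_(g in G | g \subset W) x ^+ #|g| ->
          1 <= \sum_(U' : {set V} | U' \subset W) a U' &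
        \sum_U' a U' * p ^+ #|U'| <= p ^+ #|U :|: g| * e ^+ (N - #|U :|: g|)].
  have [gG|] := boolP (g \in G); last by exists (fun=> 0).
  have [|gU] := boolP (g \subset U); first by exists (fun=> 0).
  have [||a ha] := IHn (U :|: g); last by exists a.
    apply: leq_trans hU _; rewrite addnS -addSn leq_add2r.
    by apply: proper_card; rewrite properUl.
  by rewrite subUset UG bigcup_sup.
have [a ha] := fin_all_exists Hg.
have xU : (1 + x) ^+ #|U| <= 5 / 4.
  apply: le_trans xN; apply: ler_weXn2l; first by rewrite lerDl.
  lia.
exists (fun U' => 4 * \sum_(g in G | ~~ (g \subset U)) x ^+ #|g| * a g U').
have xX_ge0 k : 0 <= x ^+ k by rewrite exprn_ge0.
split=> [U'|U'|W UW hW|].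
- rewrite mulr_ge0 // sumr_ge0 // => g /andP[gG gU].
  by rewrite mulr_ge0 //; case: (ha g gG gU).
- apply: contraNT => U'G; rewrite big1 ?mulr0 // => g /andP[gG gU].
  have [_ ag _ _] := ha g gG gU.
  have /eqP-> : a g U' == 0 by apply: contraNT U'G => /ag.
  by rewrite mulr0.
- rewrite -mulr_sumr exchange_big /=.
  have inside : \sum_(g in G | g \subset U) x ^+ #|g| <= 1 / 4.
    have := sum_expr_subset x U; rewrite (bigD1 set0) ?sub0set //= cards0 expr0.
    suff : \sum_(g in G | g \subset U) x ^+ #|g| <=
        \sum_(T : {set V} | (T \subset U) && (T != set0)) x ^+ #|T| by lra.
    apply: ler_sum_subpred => // g /andP[gG ->] /=.
    by apply: contraNneq G0 => <-.
  have outside : 1 / 4 <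
      \sum_(g | (g \in G) && (g \subset W) && ~~ (g \subset U)) x ^+ #|g|.
    move: hW; rewrite (bigID (fun g : {set V} => g \subset U)) /=.
    suff -> : \sum_(g | (g \in G) && (g \subset W) && (g \subset U)) x ^+ #|g| =
        \sum_(g in G | g \subset U) x ^+ #|g| by move: inside; lra.
    apply: eq_bigl => g; have [gU|] := boolP (g \subset U); last by rewrite !andbF.
    by rewrite (subset_trans gU UW) andbT.
  suff : \sum_(g | (g \in G) && (g \subset W) && ~~ (g \subset U)) x ^+ #|g| <=
     \sum_(g in G | ~~ (g \subset U))
        \sum_(U' : {set V} | U' \subset W) x ^+ #|g| * a g U'.
    by move: outside; lra.
  rewrite big_mkcond [leRHS]big_mkcond; apply: ler_sum => g _.
  have [gG|//] := boolP (g \in G).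
  have [gU|gU] := boolP (g \subset U); first by rewrite andbF.
  have [ag0 _ agW _] := ha g gG gU; rewrite -mulr_sumr.
  have [gW|gW] := boolP (g \subset W); last by rewrite mulr_ge0 // sumr_ge0.
  by rewrite ler_peMr // agW // subUset UW.
under eq_bigr do rewrite -mulrA mulr_suml.
rewrite -mulr_sumr exchange_big /=.
have := @expansion_cost _ _ G x p e theta N U x_ge0 p_ge0 e01 spread.
set M := p ^+ #|U| * e ^+ (N - #|U|).
have M_ge0 : 0 <= M by rewrite mulr_ge0 ?exprn_ge0 ?(ltW e_gt0).
set Sg := (X in X <= _ -> _) => cost.
have : \sum_(g in G | ~~ (g \subset U)) \sum_U' x ^+ #|g| * a g U' * p ^+ #|U'| <= Sg.
  apply: ler_sum => g /andP[gG gU]; have [_ _ _ agp] := ha g gG gU.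
  under eq_bigr do rewrite -mulrA.
  by rewrite -mulr_sumr ler_wpM2l.
have : M * ((1 + x) ^+ #|U| * theta) <= M * (1 / 4).
  apply: ler_wpM2l => //.
  have xU_ge0 : 0 <= (1 + x) ^+ #|U| by rewrite exprn_ge0 ?addr_ge0.
  by apply: le_trans (ler_wpM2l xU_ge0 theta_le) _; move: xU; lra.
by move: cost; lra.
Qed.

(** * Random lists *)
Lemma unif_subset_ge0 (R : realType) (C : finType) (l : nat) (S : {set C}) :
  0 <= unif_subset R l S.
Proof. by rewrite /unif_subset; case: ifP; rewrite ?invr_ge0 ?ler0n. Qed.

Definition contain_pr (R : realType) (C : finType) (l : nat) (D : {set C}) : R :=
  \sum_(S : {set C} | D \subset S) unif_subset R l S.

Lemma contain_pr_ge0 (R : realType) (C : finType) (l : nat) (D : {set C}) :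
  0 <= contain_pr R l D.
Proof. by apply: sumr_ge0 => S _; exact: unif_subset_ge0. Qed.

Lemma card_supersets (C : finType) (l : nat) (D : {set C}) :
  (l <= #|C|)%N ->
  #|[set S : {set C} | D \subset S & #|S| == l]| = 'C(#|C| - #|D|, #|C| - l).
Proof.
move=> lC; have -> : (#|C| - #|D| = #|~: D|)%N by rewrite (cardsCs (~: D)) setCK.
rewrite -cards_draws -(card_imset _ (@setC_inj C)) (can_imset_pre _ (@setCK C)).
apply: eq_card => S; rewrite !inE -setCS setCK (cardsCs (~: S)) setCK.
by congr (_ && _); have := max_card S; lia.
Qed.

Lemma bin_sub_ratio (q l d : nat) :
  (l <= q)%N ->
  ('C(q - d, q - l) * q ^ d <= l ^ d * 'C(q, q - l))%N.
Proof.
move=> lq; elim: d => [|d IHd]; first by rewrite subn0 !expn0 mul1n muln1.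
have [qd|dq] := leqP q d.
  have -> : (q - d.+1 = q - d)%N by lia.
  have [->|lq'] := eqVneq l q; first by rewrite subnn !bin0 mul1n muln1.
  by rewrite (_ : q - d = 0)%N ?bin0n; [rewrite (_ : (q - l == 0)%N = false) | ]; lia.
have := mul_bin_down (q - d) (q - l).
rewrite -subnS (_ : q - d - (q - l) = l - d)%N; last by lia.
move=> down; rewrite -(leq_pmul2l (_ : 0 < q - d)%N) ?subn_gt0 // mulnA down.
have : ((l - d) * q <= l * (q - d))%N by rewrite mulnBl mulnBr; nia.
rewrite !expnS; move: IHd; nia.
Qed.

Lemma contain_prE (R : realType) (C : finType) (l : nat) (D : {set C}) :
  (l <= #|C|)%N ->
  contain_pr R l D =
    'C(#|C| - #|D|, #|C| - l)%:R / 'C(#|C|, l)%:R.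
Proof.
move=> lC; rewrite -card_supersets // -sumr_const mulr_suml /contain_pr.
rewrite big_mkcond [RHS]big_mkcond; apply: eq_bigr => S _.
by rewrite inE /unif_subset; case: (D \subset S) => //=; rewrite mul1r.
Qed.

Lemma contain_pr_set0 (R : realType) (C : finType) (l : nat) :
  (l <= #|C|)%N -> contain_pr R l (set0 : {set C}) = 1.
Proof.
move=> lC; rewrite contain_prE // cards0 subn0 bin_sub // divff //.
by rewrite pnatr_eq0 -lt0n bin_gt0.
Qed.

(** Negative correlation: the colors of D belong to a uniform l-subset jointly
    with at most the probability that independent choices would give. *)
Lemma contain_pr_le (R : realType) (C : finType) (l : nat) (D : {set C}) :
  (0 < l <= #|C|)%N -> contain_pr R l D <= (l%:R / #|C|%:R) ^+ #|D|.
Proof.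
move=> /andP[l_gt0 lC]; rewrite contain_prE // expr_div_n.
rewrite ler_pdivrMr ?ltr0n ?bin_gt0 // mulrAC ler_pdivlMr; last first.
  by rewrite exprn_gt0 // ltr0n (leq_trans l_gt0).
rewrite -!natrX -!natrM ler_nat -(bin_sub lC).
exact: bin_sub_ratio.
Qed.

(** Both sides are the expected number of subsets of a list. *)
Lemma sum_contain_pr (R : realType) (C : finType) (l : nat) :
  (l <= #|C|)%N -> \sum_(D : {set C}) contain_pr R l D = 2 ^+ l.
Proof.
move=> lC; rewrite /contain_pr (exchange_big_dep xpredT) //=.
transitivity (contain_pr R l (set0 : {set C}) * 2 ^+ l); last first.
  by rewrite contain_pr_set0 // mul1r.
rewrite /contain_pr mulr_suml.
rewrite [RHS](eq_bigl xpredT) => [|S]; last by rewrite sub0set.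
apply: eq_bigr => S _; rewrite sumr_const.
rewrite /unif_subset; case: eqP => [Sl|_]; last by rewrite mul0rn mul0r.
rewrite -Sl -natrX -card_powerset mulr_natr; congr (_ *+ _).
by apply: eq_card => D; rewrite inE.
Qed.

Lemma random_lists_contain (R : realType) (V C : finType) (l : nat)
    (D : V -> {set C}) :
  \sum_(L : {ffun V -> {set C}})
     (\prod_u unif_subset R l (L u)) * [forall u, D u \subset L u]%:R =
  \prod_u contain_pr R l (D u).
Proof.
rewrite /contain_pr.
transitivity (\prod_u \sum_(S : {set C})
    if D u \subset S then unif_subset R l S else 0);
  last by apply: eq_bigr => u _; rewrite -big_mkcond.
rewrite bigA_distr_bigA; apply: eq_bigr => L _ /=.
have [/forallP sub|/forallPn[u /negPf uD]] := boolP [forall u, D u \subset L u].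
  by rewrite mulr1; apply: eq_bigr => u _; rewrite sub.
by rewrite mulr0 (bigD1 u) //= uD mul0r.
Qed.

(** Expanding the product chooses a set f c for each color c of D, and asks that
    the list of each u contains all the colors c with u in f c.  These are
    independent requirements on the lists, each of probability at most p to the
    number of colors; collecting the factors by colors instead of vertices
    restores a product over D.  The sets f c avoid v, so the list of v is only
    asked to contain D. *)
Lemma joint_witness_bound (R : realType) (V C : finType) (l : nat) (v : V)
    (a : {set V} -> R) (D : {set C}) :
  (0 < l <= #|C|)%N -> (forall U, 0 <= a U) ->
  (forall U, a U != 0 -> v \notin U) ->
  \sum_(L : {ffun V -> {set C}}) (\prod_u unif_subset R l (L u)) *
     ((D \subset L v)%:R *
      \prod_(c in D) \sum_(U : {set V} | U \subset [set u | c \in L u]) a U) <=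
  contain_pr R l D *
    (\sum_U a U * (l%:R / #|C|%:R) ^+ #|U|) ^+ #|D|.
Proof.
move=> lC a_ge0 av; set p := l%:R / #|C|%:R.
have p_ge0 : 0 <= p by rewrite divr_ge0 ?ler0n.
(* Outside D the only choice is the empty set, which asks for nothing. *)
pose A (c : C) (U : {set V}) : R := if c \in D then a U else (U == set0)%:R.
have A_ge0 c U : 0 <= A c U by rewrite /A; case: ifP; rewrite ?ler0n.
have A_v c U : A c U != 0 -> v \notin U.
  rewrite /A; case: ifP => [_|_]; first exact: av.
  by case: (eqVneq U set0) => [->|_]; rewrite ?inE ?eqxx.
pose forced (f : {ffun C -> {set V}}) (u : V) :=
  if u == v then D else [set c | u \in f c].
have prodE (L : {ffun V -> {set C}}) :
    (D \subset L v)%:R *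
      \prod_(c in D) \sum_(U : {set V} | U \subset [set u | c \in L u]) a U =
    \sum_(f : {ffun C -> {set V}}) (\prod_c A c (f c)) *
       [forall u, forced f u \subset L u]%:R.
  have -> : \prod_(c in D) \sum_(U : {set V} | U \subset [set u | c \in L u]) a U
     = \prod_c \sum_U A c U * (U \subset [set u | c \in L u])%:R.
    rewrite big_mkcond; apply: eq_bigr => c _; rewrite /A.
    case: ifP => _.
      rewrite big_mkcond; apply: eq_bigr => U _.
      by case: (_ \subset _); rewrite ?mulr1 ?mulr0.
    rewrite (bigD1 set0) //= eqxx sub0set mulr1 big1 ?addr0 // => U /negPf ->.
    by rewrite mul0r.
  rewrite bigA_distr_bigA mulr_sumr; apply: eq_bigr => f _.
  rewrite big_split /= mulrCA.
  have [->|A_neq0] := eqVneq (\prod_c A c (f c)) 0; first by rewrite !mul0r.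
  have vf c : v \notin f c by move/prodf_neq0: A_neq0 => /(_ c isT); exact: A_v.
  congr (_ * _).
  have [DL|DL] := boolP (D \subset L v); last first.
    rewrite mul0r; case: forallP => // /(_ v).
    by rewrite /forced eqxx (negPf DL).
  rewrite mul1r; have [/forallP hf|/forallPn[u hu]] :=
    boolP [forall u, forced f u \subset L u].
    rewrite big1 // => c _; suff -> : f c \subset [set u | c \in L u] by [].
    apply/subsetP => u uf; rewrite inE; have := hf u; rewrite /forced.
    case: (eqVneq u v) => [uv|_ /subsetP]; last by apply; rewrite inE.
    by have := vf c; rewrite -uv uf.
  move: hu; rewrite /forced; case: (eqVneq u v) => [->|_]; first by rewrite DL.
  case/subsetPn => c; rewrite inE => uf cL; rewrite (bigD1 c) //=.
  rewrite (_ : f c \subset _ = false) ?mul0r //; apply/negP => /subsetP/(_ u uf).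
  by rewrite inE (negPf cL).
under eq_bigr do rewrite prodE mulr_sumr.
rewrite exchange_big /=.
have -> : (\sum_U a U * p ^+ #|U|) ^+ #|D| =
    \sum_(f : {ffun C -> {set V}}) \prod_c (A c (f c) * p ^+ #|f c|).
  rewrite -(bigA_distr_bigA (fun c U => A c U * p ^+ #|U|)) -prodr_const.
  rewrite big_mkcond; apply: eq_bigr => c _; rewrite /A; case: ifP => // _.
  rewrite (bigD1 set0) //= eqxx cards0 mulr1 big1 ?addr0 // => U /negPf ->.
  by rewrite mul0r.
rewrite mulr_sumr; apply: ler_sum => f _.
under eq_bigr do rewrite mulrCA.
rewrite -mulr_sumr random_lists_contain big_split /= mulrCA.
have [->|A_neq0] := eqVneq (\prod_c A c (f c)) 0; first by rewrite !mul0r.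
apply: ler_wpM2l; first exact: prodr_ge0.
have vf c : v \notin f c by move/prodf_neq0: A_neq0 => /(_ c isT); exact: A_v.
rewrite (bigD1 v) //= {1}/forced eqxx; apply: ler_wpM2l; first exact: contain_pr_ge0.
apply: (@le_trans _ _ (\prod_(u | u != v) p ^+ #|[set c | u \in f c]|)).
  apply: ler_prod => u /negPf uv; rewrite /forced uv contain_pr_ge0 /=.
  exact: contain_pr_le.
rewrite !prodrXr.
suff -> : (\sum_(u | u != v) #|[set c | u \in f c]| = \sum_c #|f c|)%N by [].
transitivity (\sum_(u | u != v) \sum_c (u \in f c))%N.
  apply: eq_bigr => u _; rewrite -sum1_card big_mkcond.
  by apply: eq_bigr => c _; rewrite inE; case: (u \in f c).
rewrite exchange_big; apply: eq_bigr => c _; rewrite -sum1_card.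
rewrite big_mkcond [RHS]big_mkcond; apply: eq_bigr => u _.
by case: (eqVneq u v) => [->|_]; rewrite ?(negPf (vf c)) //=; case: (u \in f c).
Qed.

(** Union bound over the set D of bad colors in the list of v: the probabilities
    that the list contains D sum to 2 ^ l, and D, which has at least l / 2
    elements, is entirely bad with conditional probability at most
    (h ^ 2) ^ |D| <= h ^ l. *)
Lemma many_bad_colors_pr (R : realType) (V C : finType) (l : nat) (v : V)
    (a : {set V} -> R) (bad : pred {set V}) (h : R) :
  (0 < l <= #|C|)%N -> (forall U, 0 <= a U) ->
  (forall U, a U != 0 -> v \notin U) ->
  (forall W, bad W -> 1 <= \sum_(U : {set V} | U \subset W) a U) ->
  0 <= h <= 1 ->
  \sum_U a U * (l%:R / #|C|%:R) ^+ #|U| <= h ^+ 2 ->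
  random_lists_pr R l (fun L : {ffun V -> {set C}} =>
     (l <= 2 * #|[set c in L v | bad [set u | c \in L u]]|)%N) <= (2 * h) ^+ l.
Proof.
move=> lC a_ge0 av abad /andP[h_ge0 h_le1] ah; have [l_gt0 l_le] := andP lC.
pose mu (L : {ffun V -> {set C}}) : R := \prod_u unif_subset R l (L u).
have mu_ge0 L : 0 <= mu L by apply: prodr_ge0 => u _; exact: unif_subset_ge0.
pose wit (L : {ffun V -> {set C}}) (D : {set C}) := (D \subset L v)%:R *
  \prod_(c in D) \sum_(U : {set V} | U \subset [set u | c \in L u]) a U.
have wit_ge0 L D : 0 <= wit L D.
  by rewrite mulr_ge0 ?ler0n // prodr_ge0 // => c _; rewrite sumr_ge0.
apply: (@le_trans _ _
    (\sum_(D : {set C} | (l <= 2 * #|D|)%N) \sum_L mu L * wit L D)).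
  rewrite exchange_big /random_lists_pr big_mkcond; apply: ler_sum => L _ /=.
  rewrite -mulr_sumr; case: ifPn => [hL|_]; last by rewrite mulr_ge0 ?sumr_ge0.
  rewrite -[leLHS]mulr1; apply: ler_wpM2l; first exact: mu_ge0.
  rewrite (bigD1 [set c in L v | bad [set u | c \in L u]]) //=.
  apply: ler_wpDr; first by rewrite sumr_ge0.
  rewrite /wit (_ : _ \subset L v); last by apply/subsetP => c; rewrite inE => /andP[].
  rewrite mul1r; apply: prodr_ge1 => c; rewrite inE => /andP[_]; exact: abad.
rewrite exprMn -(sum_contain_pr R l_le) mulr_suml big_mkcond /=.
apply: ler_sum => D _; case: ifPn => hD; last first.
  by rewrite mulr_ge0 ?contain_pr_ge0 ?exprn_ge0.
apply: le_trans (joint_witness_bound _ _ _ _) _ => //.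
apply: ler_wpM2l; first exact: contain_pr_ge0.
apply: (@le_trans _ _ ((h ^+ 2) ^+ #|D|)).
  apply: lerXn2r; rewrite ?nnegrE ?exprn_ge0 ?sumr_ge0 // => U _.
  by rewrite mulr_ge0 ?exprn_ge0 ?divr_ge0 ?ler0n.
by rewrite -exprM; apply: ler_wiXn2l.
Qed.

(** The implication is only required for lists of size l, as the others have
    probability 0. *)
Lemma random_lists_union_bound (R : realType) (V C : finType) (l : nat)
    (good : pred {ffun V -> {set C}}) (bad : V -> pred {ffun V -> {set C}}) :
  (l <= #|C|)%N ->
  (forall L : {ffun V -> {set C}}, (forall v, #|L v| = l) ->
     (forall v, ~~ bad v L) -> good L) ->
  1 - \sum_v random_lists_pr R l (bad v) <= random_lists_pr R l good.
Proof.
move=> lC imp.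
pose mu (L : {ffun V -> {set C}}) : R := \prod_u unif_subset R l (L u).
have mu_ge0 L : 0 <= mu L by apply: prodr_ge0 => u _; exact: unif_subset_ge0.
have mu1 : \sum_L mu L = 1.
  transitivity (\prod_(u : V) contain_pr R l (set0 : {set C})).
    rewrite -random_lists_contain; apply: eq_bigr => L _.
    by rewrite (introT forallP) ?mulr1 // => u; exact: sub0set.
  by rewrite big1 // => u _; exact: contain_pr_set0.
rewrite -mu1 lerBlDr /random_lists_pr.
under [X in _ + X]eq_bigr do rewrite big_mkcond.
rewrite exchange_big [X in X + _]big_mkcond -big_split /=.
apply: ler_sum => L _; rewrite -/(mu L).
have sum_ge0 (P : pred V) : 0 <= \sum_(v | P v) (if bad v L then mu L else 0).
  by apply: sumr_ge0 => v _; case: ifP.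
case: ifPn => [_|nL]; first by rewrite lerDl.
rewrite add0r.
have [/forallP size_l|/forallPn[v size_v]] := boolP [forall v, #|L v| == l]; last first.
  rewrite [leLHS](_ : _ = 0) // /mu (bigD1 v) //= /unif_subset.
  by rewrite (negPf size_v) mul0r.
have [/existsP[v vbad]|/existsPn nbad] := boolP [exists v, bad v L].
  by rewrite (bigD1 v) //= vbad lerDl.
by case/negP: nL; apply: imp => // v; apply/eqP.
Qed.

(** * Heavy colors *)
Definition link (V : finType) (F : {set {set V}}) (v : V) : {set {set V}} :=
  [set f :\ v | f in [set f in F | v \in f]].

Lemma sum_link (R : nzRingType) (V : finType) (F : {set {set V}}) (v : V)
    (P : pred {set V}) (h : {set V} -> R) :
  \sum_(g in link F v | P g) h g =
  \sum_(f in F | (v \in f) && P (f :\ v)) h (f :\ v).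
Proof.
rewrite big_mkcondr big_imset => [|f f']; last first.
  rewrite !inE => /andP[_ vf] /andP[_ vf'] ff'.
  by rewrite -(setD1K vf) ff' setD1K.
rewrite -big_mkcondr; apply: eq_bigl => f.
by rewrite inE andbA.
Qed.

Lemma cover_link (V : finType) (F : {set {set V}}) (v : V) :
  v \notin cover (link F v).
Proof.
by apply/bigcupP => -[g /imsetP[f _ ->]]; rewrite !inE eqxx.
Qed.

(** Spreadness of F above v |: T is that of the link of v above T.  Every edge
    properly above has at least one further vertex, so scaling y by theta gains
    at least one factor theta. *)
Lemma link_spread (R : realFieldType) (V : finType) (F : {set {set V}})
    (y theta : R) (v : V) (T : {set V}) :
  0 < y -> 0 <= theta <= 1 ->
  (forall S : {set V}, S != set0 ->
     \sum_(f in F | S \proper f) y ^+ #|f| <= y ^+ #|S|) ->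
  \sum_(g in link F v | T \proper g) (theta * y) ^+ (#|g| - #|T|) <= theta.
Proof.
move=> y_gt0 /andP[theta_ge0 theta_le1] codeg; rewrite sum_link.
have [vT|vT] := boolP (v \in T).
  rewrite big1 // => f /and3P[_ _ /proper_sub/subsetP/(_ v vT)].
  by rewrite !inE eqxx.
have S_neq0 : v |: T != set0 by apply/set0Pn; exists v; rewrite setU11.
apply: (@le_trans _ _ (\sum_(f in F | v |: T \proper f)
    theta * (y ^+ #|f| / y ^+ #|v |: T|))).
  rewrite big_mkcond [leRHS]big_mkcond; apply: ler_sum => f _.
  case: ifPn => [/and3P[fF vf Tf]|_]; last first.
    case: ifP => // _; rewrite !mulr_ge0 ?invr_ge0 ?exprn_ge0 ?(ltW y_gt0) //.
  have Sf : v |: T \proper f.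
    move: Tf; rewrite !properEcard subUset sub1set vf subsetD1 vT andbT => /andP[-> /=].
    by rewrite (cardsD1 v f) vf cardsU1 vT ltn_add2l.
  rewrite fF Sf /= -expfB ?(proper_card Sf) //.
  have -> : (#|f :\ v| - #|T| = #|f| - #|v |: T|)%N.
    by rewrite (cardsD1 v f) vf cardsU1 vT subnDl.
  have : (0 < #|f| - #|v |: T|)%N by rewrite subn_gt0 proper_card.
  case: (_ - _)%N => // m _; rewrite exprMn ler_pM2r ?exprn_gt0 //.
  by rewrite exprS ler_piMr // exprn_ile1.
rewrite -mulr_sumr -mulr_suml ler_piMr // ler_pdivrMr ?exprn_gt0 // mul1r.
exact: codeg.
Qed.

Definition heavy (R : realFieldType) (V : finType) (F : {set {set V}})
    (l : nat) (v : V) (W : {set V}) : bool :=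
  1 / 2 < \sum_(g in link F v | g \subset W) (4 / l%:R : R) ^+ #|g|.

Definition nb_heavy_colors (R : realFieldType) (V C : finType)
    (F : {set {set V}}) (l : nat) (L : {ffun V -> {set C}}) (v : V) : nat :=
  #|[set c in L v | heavy R F l v [set u | c \in L u]]|.

(** A vertex that drops its heavy colors keeps at least l / 2 colors, each of
    which loses at most half of the extensions: at least l / 4 remain, and 4 / l
    is the base of the weights in the definition of heavy colors. *)
Lemma list_colorable_of_few_heavy (R : realFieldType) (V C : finType)
    (E F : {set {set V}}) (l : nat) (L : {ffun V -> {set C}}) :
  (0 < l)%N ->
  (forall e, e \in E -> exists2 f, f \in F & f \subset e) ->
  (forall f, f \in F -> (2 <= #|f|)%N) ->
  (forall v, #|L v| = l) ->
  (forall v, (2 * nb_heavy_colors R F l L v < l)%N) ->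
  list_colorable E L.
Proof.
move=> l_gt0 cov Fsize Ll few.
have lR_gt0 : 0 < l%:R :> R by rewrite ltr0n.
pose H v := [set c in L v | heavy R F l v [set u | c \in L u]].
pose L' v := L v :\: H v.
have L'size v : (l%:R : R) <= 2 * #|L' v|%:R.
  rewrite -natrM ler_nat cardsD Ll (setIidPr _).
    by have := few v; rewrite /nb_heavy_colors -/(H v); lia.
  by apply/subsetP => c; rewrite inE => /andP[].
have light v c : c \in L' v ->
    \sum_(f in F | (v \in f) && [forall u in f :\ v, c \in L' u])
       (l%:R / 4 : R) ^- #|f|.-1 <= 1 / 2.
  rewrite !inE => /andP[+ cL]; rewrite cL /= -leNgt; apply: le_trans.
  rewrite sum_link big_mkcond [leRHS]big_mkcond; apply: ler_sum => f _.
  have [/and3P[fF vf /forall_inP hf]|_] := ifPn; last first.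
    by case: ifP => // _; rewrite exprn_ge0 ?divr_ge0 ?ler0n.
  rewrite fF vf /= (_ : _ \subset _ = true); last first.
    by apply/subsetP => u /hf; rewrite !inE => /andP[].
  by rewrite -exprVn invf_div (cardsD1 v f) vf.
have [||v|chi chiL chiF] := @list_coloring_by_counting R V C F L' (l%:R / 4).
- by rewrite divr_gt0.
- exact: Fsize.
- apply: (@le_trans _ _ (\sum_(c in L' v) (1 / 2 : R))).
    by rewrite sumr_const -mulr_natr; have := L'size v; lra.
  by apply: ler_sum => c /light; lra.
apply/existsP; exists chi; apply/andP; split.
  apply/forall_inP => e /cov[f fF /subsetP fe]; apply: contra (chiF f fF).
  move=> /forall_inP mono; apply/forall_inP => u /fe ue.
  by apply/forall_inP => w /fe we; exact: (forall_inP (mono u ue)).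
by apply/forallP => v; have := chiL v; rewrite inE => /andP[].
Qed.

(** * The probability of failure *)
Lemma small_growth (R : realType) (l : nat) :
  (0 < l)%N -> (1 + 4 / l%:R) ^+ (l %/ 20) <= 5 / 4 :> R.
Proof.
move=> l_gt0; have lR : 0 < l%:R :> R by rewrite ltr0n.
have N_le : 20 * (l %/ 20)%:R <= l%:R :> R.
  by rewrite -natrM ler_nat mulnC leq_divM.
apply: (@le_trans _ _ (expR (4 / l%:R) ^+ (l %/ 20))).
  by apply: lerXn2r; rewrite ?nnegrE ?addr_ge0 ?divr_ge0 ?expR_ge0 ?expR_ge1Dx ?ler0n.
rewrite -expRM_natr; apply: (@le_trans _ _ (expR (1 / 5))).
  rewrite ler_expR mulrAC ler_pdivrMr //; lra.
have := expR_ge1Dx (- (1 / 5) : R); have := expRxMexpNx_1 (1 / 5 : R).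
have := expR_gt0 (1 / 5 : R); nra.
Qed.

(** Here [witness_weights] is used with e = 1/16 and theta = 1/5.  The weight
    of a new vertex is x p / e = (4 / l) (l / Q) 16 = 64 / Q, one fifth of the
    weight 320 / Q for which F is spread; this is where 320 comes from. *)
Lemma heavy_vertex_pr (R : realType) (V C : finType) (F : {set {set V}})
    (l : nat) (v : V) :
  (0 < l <= #|C|)%N ->
  (forall f, f \in F -> (2 <= #|f|)%N) ->
  (forall S : {set V}, S != set0 ->
     \sum_(f in F | S \proper f) (320 / #|C|%:R : R) ^+ #|f| <=
     (320 / #|C|%:R) ^+ #|S|) ->
  random_lists_pr R l (fun L : {ffun V -> {set C}} =>
     (l <= 2 * nb_heavy_colors R F l L v)%N) <=
    (2 * (1 / 4) ^+ (l %/ 20)) ^+ l.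
Proof.
move=> lC Fsize codeg; have [l_gt0 l_le] := andP lC.
have lR : 0 < l%:R :> R by rewrite ltr0n.
have CR : 0 < #|C|%:R :> R by rewrite ltr0n (leq_trans l_gt0).
have [||||||T|a [a_ge0 a_cov a_wit a_cost]] := @witness_weights R V (link F v)
  (4 / l%:R) (l%:R / #|C|%:R) (1 / 16) (1 / 5) (l %/ 20).
- by rewrite divr_ge0 ?ler0n.
- by rewrite divr_ge0 ?ler0n.
- by lra.
- apply/imsetP => -[f]; rewrite inE => /andP[/Fsize + vf] f0.
  by rewrite (cardsD1 v) vf -f0 cards0.
- exact: small_growth.
- by [].
- have -> : 4 / l%:R * (l%:R / #|C|%:R) / (1 / 16) = 1 / 5 * (320 / #|C|%:R) :> R.
    by field; rewrite !gt_eqF.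
  apply: link_spread codeg; [by rewrite divr_gt0 | lra].
apply: (@many_bad_colors_pr _ _ _ _ _ a (heavy R F l v)) => //.
- move=> U /a_cov /subsetP Ucov; apply/negP => /Ucov; apply/negP; exact: cover_link.
- by rewrite exprn_ge0 ?exprn_ile1 //; lra.
- apply: le_trans a_cost _; rewrite -exprM mulnC exprM.
  by rewrite (_ : (1 / 4) ^+ 2 = 1 / 16 :> R) //; field.
Qed.

(** When all lists are the whole palette, spreadness above the empty subset of
    the link bounds the whole sum: 4 / Q is 1/80 of 320 / Q. *)
Lemma heavy_never (R : realFieldType) (V C : finType) (F : {set {set V}})
    (l : nat) (L : {ffun V -> {set C}}) (v : V) :
  (0 < l)%N -> l = #|C| ->
  (forall f, f \in F -> (2 <= #|f|)%N) ->
  (forall S : {set V}, S != set0 ->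
     \sum_(f in F | S \proper f) (320 / #|C|%:R : R) ^+ #|f| <=
     (320 / #|C|%:R) ^+ #|S|) ->
  nb_heavy_colors R F l L v = 0%N.
Proof.
move=> + lC; rewrite lC => C_gt0 Fsize codeg.
have CR : 0 < #|C|%:R :> R by rewrite ltr0n.
apply/eqP; rewrite cards_eq0; apply/eqP/setP => c; rewrite !inE.
apply/negbTE; rewrite negb_and -leNgt; apply/orP; right.
have := @link_spread R V F (320 / #|C|%:R) (1 / 80) v set0.
have -> : 1 / 80 * (320 / #|C|%:R) = 4 / #|C|%:R :> R by field; rewrite gt_eqF.
rewrite cards0 => /(_ _ _ codeg) spread.
apply: (@le_trans _ _ (1 / 80 : R)); last lra.
apply: le_trans (spread _ _); [|by rewrite divr_gt0|lra].
rewrite big_mkcond [leRHS]big_mkcond; apply: ler_sum => g _; rewrite subn0.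
case: ifPn => [/andP[gF _]|_]; last first.
  by case: ifP => // _; rewrite exprn_ge0 ?divr_ge0 ?ler0n.
rewrite gF proper0 /= ifT //.
move: gF => /imsetP[f + ->]; rewrite inE => /andP[/Fsize + vf].
by rewrite -card_gt0 (cardsD1 v f) vf.
Qed.

(** With N = l %/ 20 >= l / 40 the left side is at most 2 ^ (- N l), and
    N l >= l ^ 2 / 40 >= 10 ln n.  The condition n >= 4 > exp 1 gives l >= 20,
    without which N would vanish. *)
Lemma failure_le (R : realType) (n l : nat) :
  (4 <= n)%N -> 20 * Num.sqrt (ln n%:R) <= l%:R :> R ->
  (2 * (1 / 4) ^+ (l %/ 20)) ^+ l <= n%:R ^- 2 :> R.
Proof.
move=> n_ge4 l_ge; have half : 1 / 2 <= expR (- (1 / 2)) :> R.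
  by have := expR_ge1Dx (- (1 / 2) : R); lra.
have n_gt0 : 0 < n%:R :> R by rewrite ltr0n; lia.
have nE : expR (ln n%:R) = n%:R :> R by rewrite lnK ?posrE.
have ln_ge1 : 1 <= ln n%:R :> R.
  rewrite -ler_expR nE; apply: (@le_trans _ _ (4%:R : R)); last by rewrite ler_nat.
  have := expRxMexpNx_1 (1 : R); have := expR_gt0 (1 : R).
  have -> : expR (- (1 : R)) = expR (- (1 / 2)) ^+ 2.
    by rewrite -expRM_natr; congr expR; field.
  move: half; move: (expR (- (1 / 2))) (expR 1) => z t z_ge t_gt0 tz.
  have z2_ge : 1 / 4 <= z ^+ 2 by rewrite expr2; nra.
  have := ler_wpM2l (ltW t_gt0) z2_ge; rewrite tz; lra.
have s_ge0 := sqrtr_ge0 (ln n%:R : R).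
have sE : Num.sqrt (ln n%:R : R) ^+ 2 = ln n%:R by rewrite sqr_sqrtr //; lra.
move: s_ge0 sE l_ge; move: (Num.sqrt _) => s s_ge0 sE l_ge.
have s_ge1 : 1 <= s by rewrite -sE in ln_ge1; nra.
have l_ge20 : (20 <= l)%N by rewrite -(ler_nat R); lra.
have N_ge1 : (0 < l %/ 20)%N by lia.
have Nl_ge : 10 * ln n%:R <= (l %/ 20 * l)%:R :> R.
  have : l%:R <= 40 * (l %/ 20)%:R :> R by rewrite -natrM ler_nat; lia.
  by rewrite -sE natrM; nra.
move: N_ge1 Nl_ge; move: (l %/ 20)%N => N N_ge1 Nl_ge.
apply: (@le_trans _ _ ((1 / 2) ^+ N ^+ l)).
  apply: lerXn2r; rewrite ?nnegrE ?mulr_ge0 ?exprn_ge0 //; try lra.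
  rewrite (_ : 1 / 4 = 1 / 2 * (1 / 2) :> R); last by field.
  rewrite exprMn mulrA; apply: ler_piMl; first by apply: exprn_ge0; lra.
  case: N N_ge1 {Nl_ge} => // N _; rewrite exprS mulrA.
  rewrite (_ : 2 * (1 / 2) = 1 :> R); last by field.
  by rewrite [leLHS]mul1r; apply: exprn_ile1; lra.
rewrite -exprM; apply: (@le_trans _ _ (expR (- (1 / 2)) ^+ (N * l))).
  by apply: lerXn2r; rewrite ?nnegrE ?expR_ge0 //; lra.
rewrite -expRM_natr -nE -exprVn -expRN -expRM_natr ler_expR; lra.
Qed.

Lemma palette_size_ge (R : realType) (A Delta : R) (r : nat) :
  A * Delta `^ (r%:R - 1)^-1 <= (palette_size A Delta r)%:R.
Proof.
by rewrite /palette_size natr_absz (le_trans (ceil_ge _)) // ler_int ler_norm.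
Qed.

(** Since y = 320 / Q <= Delta ^ (- 1 / (r - 1)), the at most Delta edges at v
    weigh at most Delta y ^ r <= y; larger edges weigh less as y <= 1. *)
Lemma initial_weight (R : realType) (V : finType) (E : {set {set V}}) (A Delta : R)
    (r : nat) :
  (2 <= r)%N -> 320 <= A -> 1 <= Delta ->
  (max_degree E)%:R <= Delta ->
  (forall e : {set V}, e \in E -> (r <= #|e|)%N) ->
  let Q := palette_size A Delta r in
  0 < Q%:R :> R /\ forall v,
  \sum_(e in E | v \in e) (320 / Q%:R : R) ^+ #|e| <= 320 / Q%:R.
Proof.
move=> r_ge2 A_ge D_ge1 degE sizeE Q.
have := palette_size_ge A Delta r; rewrite -/Q.
set w := Delta `^ _ => Q_ge.
have r1E : r%:R - 1 = r.-1%:R :> R by case: (r) r_ge2 => // m _; rewrite -natr1 addrK.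
have w_ge1 : 1 <= w.
  rewrite -(powRr0 Delta) ler_powR // invr_ge0 r1E ler0n //.
have wE : w ^+ r.-1 = Delta.
  rewrite -powR_mulrn ?(le_trans ler01) // /w -powRrM r1E mulVf ?powRr1 //; first lra.
  by rewrite pnatr_eq0; lia.
have Q_ge' : 320 * w <= Q%:R by nra.
have Q_gt0 : 0 < Q%:R :> R by nra.
split=> // v; set y := 320 / Q%:R.
have y_gt0 : 0 < y by rewrite divr_gt0.
have yw : y <= w^-1.
  rewrite /y ler_pdivrMr // mulrC ler_pdivlMr //; lra.
have y_le1 : y <= 1 by rewrite (le_trans yw) // invf_le1 //; lra.
apply: (@le_trans _ _ (\sum_(e in E | v \in e) y ^+ r)).
  apply: ler_sum => e /andP[/sizeE re _]; apply: ler_wiXn2l => //; exact: ltW.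
rewrite sumr_const -mulr_natr.
have deg_le : #|[pred e in E | v \in e]|%:R <= Delta.
  apply: le_trans degE; rewrite ler_nat.
  apply: leq_trans (leq_bigmax v).
  by rewrite /degree; apply/eq_leq/eq_card => e; rewrite !inE.
apply: (@le_trans _ _ (y ^+ r * Delta)).
  by apply: ler_wpM2l deg_le; rewrite exprn_ge0 // ltW.
rewrite -(prednK (ltnW r_ge2)) exprS -mulrA ler_piMr //; first exact: ltW.
rewrite -wE -exprMn exprn_ile1 //; first by rewrite mulr_ge0 //; lra.
by rewrite -ler_pdivlMr ?mul1r //; lra.
Qed.

Theorem corollary7 (R : realType) :
  exists A0 K0 : R, [/\ 0 < A0, 0 < K0 &
  forall A K : R, A0 <= A -> K0 <= K ->
  forall r k : nat, (2 <= r)%N -> (r <= k)%N ->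
  exists c : R, 0 < c /\
  exists n0 : nat, forall n : nat, (n0 <= n)%N ->
  forall Delta : R, 1 <= Delta ->
  forall (V : finType) (E : {set {set V}}),
    #|V| = n ->
    (max_degree E)%:R <= Delta ->
    (forall e : {set V}, e \in E -> (r <= #|e| <= k)%N) ->
    let Q := palette_size A Delta r in
    let l := list_size K n Q in
    1 - n%:R `^ (- c) <=
      random_lists_pr R l (fun L : {ffun V -> {set 'I_Q}} => list_colorable E L)].
Proof.
exists 320, 20; split=> // A K A_ge K_ge r k r_ge2 rk.
exists 1; split=> //; exists 4%N.
move=> n n_ge4 Delta D_ge1 V E Vn degE sizeE.
(* The inequality is a boolean, so the local definitions are below is_true. *)
cbv zeta; set Q := palette_size A Delta r; set l := list_size K n Q.
have sizeE_r e : e \in E -> (r <= #|e|)%N by move=> /sizeE/andP[].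
have [Q_gt0 weight] := initial_weight r_ge2 A_ge D_ge1 degE sizeE_r.
rewrite -/Q in Q_gt0 weight.
have [||F [cov Fsize codeg]] := @codegree_reduction R V E (320 / Q%:R) _ _ weight.
- by rewrite divr_gt0.
- by move=> e /sizeE_r; apply: leq_trans.
have n_gt0 : 0 < n%:R :> R by rewrite ltr0n; lia.
have l_ge : l != Q -> 20 * Num.sqrt (ln n%:R) <= l%:R :> R.
  move=> lQ; have -> : l = `|Num.ceil (K * Num.sqrt (ln n%:R))|%N.
    by move: lQ; rewrite /l /list_size /minn; case: ifP; rewrite ?eqxx.
  rewrite natr_absz; apply: (@le_trans _ _ (K * Num.sqrt (ln n%:R))).
    by rewrite ler_wpM2r ?sqrtr_ge0.
  by apply: le_trans (ceil_ge _) _; rewrite ler_int ler_norm.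
have cardQ : #|'I_Q| = Q by rewrite card_ord.
have Q_gt0' : (0 < Q)%N by rewrite ltr0n in Q_gt0.
have lC : (l <= #|'I_Q|)%N by rewrite cardQ geq_minl.
have l_gt0 : (0 < l)%N.
  have [->//|/l_ge l_ge'] := eqVneq l Q.
  rewrite -(ltr0n R); apply: lt_le_trans l_ge'.
  by rewrite mulr_gt0 // sqrtr_gt0 ln_gt0 // ltr1n; lia.
rewrite -cardQ in codeg.
have := @random_lists_union_bound R V 'I_Q l (fun L => list_colorable E L)
  (fun v L => (l <= 2 * nb_heavy_colors R F l L v)%N) lC.
move=> union; apply: le_trans (union _); last first.
  move=> L Ll few; apply: (@list_colorable_of_few_heavy R) l_gt0 cov Fsize Ll _ => v.
  by rewrite ltnNge; exact: few.
rewrite lerD2l lerN2 powR_inv1; last exact: ltW.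
apply: (@le_trans _ _ (\sum_(v : V) n%:R ^- 2)); last first.
  rewrite sumr_const Vn -[leLHS]mulr_natl expr2 invfM mulrA divff ?mul1r //.
  exact: lt0r_neq0.
apply: ler_sum => v _; have [lQ|/l_ge l_ge'] := eqVneq l Q.
  rewrite /random_lists_pr big_pred0 => [|L]; first by rewrite invr_ge0 exprn_ge0 ?ltW.
  rewrite heavy_never // ?muln0 ?cardQ //.
  by rewrite leqNgt l_gt0.
apply: le_trans (failure_le n_ge4 l_ge').
by apply: heavy_vertex_pr; rewrite ?l_gt0.
Qed.
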